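(* Let $\Lambda$ be a Noetherian semiperfect ring. Assume that for each simple module $S \in \mathsf{mod}\,\Lambda$ there is an integer $n_S \geq 0$ such that $\Sigma^{n_S}\Omega^{n_S} S$ is torsionfree. Then $\operatorname{dell}\Lambda \leq \sup_S n_S < \infty$.
   Context: Noetherian means two-sided Noetherian. $\mathsf{mod}\,\Lambda$ is the category of finitely presented right $\Lambda$-modules. The stable category $\underline{\mathsf{mod}}\, \Lambda$ has the same objects, with morphisms taken modulo those factoring through projective objects; a stable retract is a retract in $\underline{\mathsf{mod}}\,\Lambda$. The syzygy functor $\Omega$ on $\underline{\mathsf{mod}}\,\Lambda$ is $\Omega M = \ker(P \twoheadrightarrow M)$ for any epimorphism from a projective $P$ in $\mathsf{mod}\,\Lambda$. The Auslander–Bridger transpose $\mathrm{Tr} : \underline{\mathsf{mod}}\,\Lambda \to \underline{\mathsf{mod}}\,\Lambda^{op}$ sends $M$ with presentation $P_1 \to P_0 \to M \to 0$ by finitely generated projectives to $\mathrm{coker}(P_0^* \to P_1^* )$, $(-)^* = \mathrm{Hom}(-,\Lambda)$; it is a contravariant duality, and $\Sigma := \mathrm{Tr}\,\Omega\,\mathrm{Tr}$ on $\underline{\mathsf{mod}}\,\Lambda$. A module $M$ is torsionfree if the canonical evaluation map $\sigma : M \to M^{**}$ is injective (this is invariant under stable equivalence, so makes sense for objects of $\underline{\mathsf{mod}}\,\Lambda$). For $M \in \mathsf{mod}\,\Lambda$, $\operatorname{dell} M := \inf\{ n \geq 0 \mid \Omega^n M \text{ is a stable retract of } \Omega^{n+1}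 N \text{ for some } N \in \underline{\mathsf{mod}}\, \Lambda\}$ ($\infty$ if no such $n$), and $\operatorname{dell} \Lambda := \sup_S \operatorname{dell} S$ over the simple $S \in \mathsf{mod}\,\Lambda$ (finitely many up to isomorphism). *)

(* Defs.v *)
From HB Require Import structures.
From mathcomp Require Import all_boot all_order all_algebra.
From mathcomp Require Import boolp.

Set Implicit Arguments.
Unset Strict Implicit.
Unset Printing Implicit Defensive.

Import GRing.Theory.
Local Open Scope ring_scope.

(* Module notions are written for left R-modules, i.e. lmodType R. Right      *)
(* modules over a ring L are left modules over the converse ring L^c, so      *)
(* mod L is fpmod L^c and mod L^op is fpmod L.                                *)

Section Ideals.
Variable R : pzRingType.
Implicit Types I J : R -> Prop.

Definition left_ideal I : Prop :=
  [/\ I 0, forall x y, I x -> I y -> I (x + y) & forall a x, I x -> I (a * x)].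

Definition right_ideal I : Prop :=
  [/\ I 0, forall x y, I x -> I y -> I (x + y) & forall a x, I x -> I (x * a)].

Definition ascending_chain_condition (ideal : (R -> Prop) -> Prop) : Prop :=
  forall I : nat -> R -> Prop,
    (forall n, ideal (I n)) ->
    (forall n x, I n x -> I n.+1 x) ->
    exists n, forall m, (n <= m)%N -> forall x, I m x -> I n x.

Definition noetherian : Prop :=
  ascending_chain_condition left_ideal /\ ascending_chain_condition right_ideal.

Definition maximal_right_ideal I : Prop :=
  [/\ right_ideal I, ~ I 1 &
      forall J, right_ideal J -> (forall x, I x -> J x) -> ~ J 1 ->
      forall x, J x -> I x].

Definition jacobson_radical (x : R) : Prop :=
  forall I, maximal_right_ideal I -> I x.

(* The right module R/I is semisimple: every submodule, i.e. every right      *)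
(* ideal A containing I, is a direct summand modulo I.                        *)
Definition semisimple_quotient I : Prop :=
  forall A, right_ideal A -> (forall x, I x -> A x) ->
  exists B, [/\ right_ideal B, forall x, I x -> B x,
    forall x, exists a b, [/\ A a, B b & x = a + b] &
    forall x, A x -> B x -> I x].

Definition idempotents_lift_modulo I : Prop :=
  forall x, I (x * x - x) -> exists e, e * e = e /\ I (e - x).

Definition semiperfect : Prop :=
  semisimple_quotient jacobson_radical /\
  idempotents_lift_modulo jacobson_radical.

End Ideals.

Section Modules.
Variable R : pzRingType.
Implicit Types M N P : lmodType R.

Definition surjective_fun (A B : Type) (f : A -> B) : Prop :=
  forall y, exists x, f x = y.

Definition exact_at (A B : Type) (C : zmodType) (f : A -> B) (g : B -> C) :=
  forall y, g y = 0 <-> exists x, f x = y.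

Definition isomorphic M N : Prop :=
  exists f : {linear M -> N}, bijective f.

Definition finitely_presented M : Prop :=
  exists (m n : nat) (d : {linear 'rV[R]_m -> 'rV[R]_n})
         (p : {linear 'rV[R]_n -> M}),
    exact_at d p /\ surjective_fun p.

Definition projective P : Prop :=
  forall (M N : lmodType R) (g : {linear M -> N}) (f : {linear P -> N}),
    surjective_fun g -> exists h : {linear P -> M}, forall x, g (h x) = f x.

Definition submodule M (U : M -> Prop) : Prop :=
  [/\ U 0, forall x y, U x -> U y -> U (x + y) & forall a x, U x -> U (a *: x)].

Definition simple_module M : Prop :=
  (exists x : M, x <> 0) /\
  forall U : M -> Prop, submodule U ->
    (forall x, U x -> x = 0) \/ (forall x, U x).

End Modules.

Record fpmod (R : pzRingType) := FPMod {
  fpmod_sort :> lmodType R;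
  fpmodP : finitely_presented fpmod_sort }.

Section Dual.
Variables (R : pzRingType) (M : lmodType R).

Definition dual : Type := {linear M -> R^o}.
Definition dual_apply (f : dual) : {linear M -> R^o} := f.
Coercion dual_apply : dual >-> GRing.Linear.type.

Lemma dualP (f g : dual) : (forall x, f x = g x) -> f = g.
Proof.
case: f g => f [[fD] [fZ]] [g [[gD] [gZ]]] /= fg.
have {}fg : f = g by apply: funext.
subst g; congr (GRing.Linear.Pack (GRing.Linear.Class _ _)).
  by congr Algebra.isNmodMorphism.Axioms_; exact: Prop_irrelevance.
by congr GRing.isScalable.Axioms_; exact: Prop_irrelevance.
Qed.

HB.instance Definition _ := gen_eqMixin dual.
HB.instance Definition _ := gen_choiceMixin dual.

Definition dual_zero : dual := (\0 : {linear M -> R^o}).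
Definition dual_opp (f : dual) : dual := (\- f : {linear M -> R^o}).
Definition dual_add (f g : dual) : dual := (f \+ g : {linear M -> R^o}).

Definition dual_scale_fun (a : R) (f : dual) (x : M) : R^o := f x * a.

Lemma dual_scale_fun_linear a f : linear (dual_scale_fun a f).
Proof. by move=> b x y; rewrite /dual_scale_fun linearP mulrDl /= -mulrA. Qed.

HB.instance Definition _ a f :=
  GRing.isLinear.Build R M R^o *:%R (dual_scale_fun a f)
    (dual_scale_fun_linear a f).

Definition dual_scale (a : R^c) (f : dual) : dual :=
  (dual_scale_fun a f : {linear M -> R^o}).

Lemma dual_addA : associative dual_add.
Proof. by move=> f g h; apply: dualP => x /=; rewrite addrA. Qed.
Lemma dual_addC : commutative dual_add.
Proof. by move=> f g; apply: dualP => x /=; rewrite addrC. Qed.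
Lemma dual_add0 : left_id dual_zero dual_add.
Proof. by move=> f; apply: dualP => x /=; rewrite add0r. Qed.
Lemma dual_addN : left_inverse dual_zero dual_opp dual_add.
Proof. by move=> f; apply: dualP => x /=; rewrite addNr. Qed.

HB.instance Definition _ :=
  GRing.isZmodule.Build dual dual_addA dual_addC dual_add0 dual_addN.

Lemma dual_scaleA a b f : dual_scale a (dual_scale b f) = dual_scale (a * b) f.
Proof. by apply: dualP => x /=; rewrite /dual_scale_fun /= -mulrA. Qed.
Lemma dual_scale1 : left_id 1 dual_scale.
Proof. by move=> f; apply: dualP => x /=; rewrite /dual_scale_fun mulr1. Qed.
Lemma dual_scaleDr : right_distributive dual_scale +%R.
Proof. by move=> a f g; apply: dualP => x /=; rewrite /dual_scale_fun mulrDl. Qed.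
Lemma dual_scaleDl f : {morph dual_scale^~ f : a b / a + b}.
Proof. by move=> a b; apply: dualP => x /=; rewrite /dual_scale_fun mulrDr. Qed.

HB.instance Definition _ :=
  GRing.Zmodule_isLmodule.Build R^c dual
    dual_scaleA dual_scale1 dual_scaleDr dual_scaleDl.

End Dual.

Definition dual_map (R : pzRingType) (M N : lmodType R) (d : {linear M -> N})
  (f : dual N) : dual M := (f \o d : {linear M -> R^o}).

Section Evaluation.
Variables (R : pzRingType) (M : lmodType R).

Definition evaluation_fun (x : M) (f : dual M) : R^c^o := f x.

Lemma evaluation_fun_linear x : linear (evaluation_fun x).
Proof. by []. Qed.

HB.instance Definition _ x :=
  GRing.isLinear.Build R^c (dual M) R^c^o *:%R (evaluation_fun x)
    (evaluation_fun_linear x).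

Definition evaluation (x : M) : dual (dual M) :=
  (evaluation_fun x : {linear dual M -> R^c^o}).

Definition torsionfree : Prop := injective evaluation.

End Evaluation.

(* R^c^c has the same operations as R but is not convertible to R as a ring   *)
(* structure; ccmod M is M viewed as an R^c^c-module.                         *)
Definition ccmod (R : pzRingType) (M : lmodType R) : Type := M.

Section ConverseConverse.
Variables (R : pzRingType) (M : lmodType R).

HB.instance Definition _ := GRing.Zmodule.on (ccmod M).

Definition ccmod_scale (a : R^c^c) (x : ccmod M) : ccmod M :=
  (a : R) *: (x : M).

Lemma ccmod_scaleA a b x :
  ccmod_scale a (ccmod_scale b x) = ccmod_scale (a * b) x.
Proof. exact: scalerA. Qed.
Lemma ccmod_scale1 : left_id 1 ccmod_scale.
Proof. exact: scale1r. Qed.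
Lemma ccmod_scaleDr : right_distributive ccmod_scale +%R.
Proof. by move=> a x y; exact: (@scalerDr R M). Qed.
Lemma ccmod_scaleDl x : {morph ccmod_scale^~ x : a b / a + b}.
Proof. by move=> a b; exact: (@scalerDl R M). Qed.

HB.instance Definition _ :=
  GRing.Zmodule_isLmodule.Build R^c^c (ccmod M)
    ccmod_scaleA ccmod_scale1 ccmod_scaleDr ccmod_scaleDl.

End ConverseConverse.

Section StableCategory.
Variable R : pzRingType.
Implicit Types M N P K X : fpmod R.

(* f and g are the same morphism of the stable category: their difference     *)
(* factors through a projective object.                                       *)
Definition stable_eq M N (f g : {linear M -> N}) : Prop :=
  exists (P : fpmod R) (a : {linear M -> P}) (b : {linear P -> N}),
    projective P /\ forall x, f x - g x = b (a x).

Definition stable_retract M N : Prop :=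
  exists (f : {linear M -> N}) (g : {linear N -> M}),
    stable_eq (g \o f : {linear M -> M}) (idfun : {linear M -> M}).

(* Omega, Tr and Sigma are defined on objects only up to stable isomorphism,  *)
(* depending on chosen presentations, so they are rendered as relations: K is *)
(* a value of Omega M, T is a value of Tr M, X is a value of Sigma M.         *)
Definition is_syzygy M K : Prop :=
  exists (P : fpmod R) (i : {linear K -> P}) (p : {linear P -> M}),
    [/\ projective P, injective i, exact_at i p & surjective_fun p].

Definition is_transpose (M : lmodType R) (T : lmodType R^c) : Prop :=
  exists (P1 P0 : fpmod R) (d : {linear P1 -> P0}) (p : {linear P0 -> M})
         (q : {linear dual P1 -> T}),
    [/\ projective P1, projective P0, exact_at d p /\ surjective_fun p &
        exact_at (dual_map d) q /\ surjective_fun q].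

End StableCategory.

Definition is_sigma (R : pzRingType) (M X : fpmod R) : Prop :=
  exists T K : fpmod R^c,
    [/\ is_transpose M T, is_syzygy T K &
        is_transpose K (ccmod X : lmodType R^c^c)].

Fixpoint iter_rel (T : Type) (r : T -> T -> Prop) (n : nat) (x y : T) : Prop :=
  if n is n'.+1 then exists z, iter_rel r n' x z /\ r z y else x = y.

Definition sigma_omega_torsionfree (R : pzRingType) (n : nat) (M : fpmod R) :=
  exists K X : fpmod R,
    [/\ iter_rel (@is_syzygy R) n M K, iter_rel (@is_sigma R) n K X &
        torsionfree X].

(* None is infinity. *)
Definition enat := option nat.

Definition enat_le (a b : enat) : Prop :=
  match a, b with
  | _, None => True
  | None, Some _ => False
  | Some m, Some n => (m <= n)%N
  end.

Definition enat_inf (A : nat -> Prop) : enat :=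
  match pselect (exists n, `[< A n >]) with
  | left exA => Some (ex_minn exA)
  | right _ => None
  end.

(* The least upper bound; 0 for the empty family. *)
Definition enat_sup (A : enat -> Prop) : enat :=
  enat_inf (fun n => forall a, A a -> enat_le a (Some n)).

Definition dell (R : pzRingType) (M : fpmod R) : enat :=
  enat_inf (fun n => exists K N L : fpmod R,
    [/\ iter_rel (@is_syzygy R) n M K, iter_rel (@is_syzygy R) n.+1 N L &
        stable_retract K L]).

Definition sup_simple (R : pzRingType) (f : fpmod R -> enat) : enat :=
  enat_sup (fun a => exists S : fpmod R, simple_module S /\ a = f S).

Definition dell_ring (L : pzRingType) : enat := sup_simple (@dell L^c).

(* Main.v *)
From HB Require Import structures.
Require Import Defs.
From mathcomp Require Import all_boot all_order all_algebra.
From mathcomp Require Import boolp.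

(* Sigma^n is stably left adjoint to Omega^n, so by a triangle identity       *)
(* K = Omega^n M is a stable retract of Omega^n X, where X = Sigma^n K. If X  *)
(* is torsionfree then, X^* being finitely generated, X embeds in a free      *)
(* module; hence X = Omega N for a cokernel N, K is a stable retract of       *)
(* Omega^(n+1) N, and dell M <= n. The bound is uniform over the simple       *)
(* modules because there are only finitely many of them.                      *)

Set Implicit Arguments.
Unset Strict Implicit.
Unset Printing Implicit Defensive.

Import GRing.Theory.
Local Open Scope ring_scope.

(** The core is [syzygy_stable_retract]: if K is an n-th syzygy and X a value of Sigma^n at K, then
    K is a stable retract of every n-th syzygy of X. This triangle identity is proved on objects,
    without building functors. From the two transposes in Sigma, [sigma_cosyzygy_data] extracts a
    complex K -> F -> X with F projective, along which maps from K to projectives extend to F up to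
    a map through a projective. [cosyzygy_syzygy_adjunction] turns this into the half of the
    adjunction that is needed, and [iter_sigma_syzygy_adjunction] iterates it. If X is torsionfree,
    finitely many generators of its dual are the coordinates of an embedding into a free module, so
    X is the syzygy of the cokernel ([torsionfree_is_syzygy]). The n-th syzygy of X is then an
    (n+1)-st syzygy, which gives [dell_le]. Finally, every sequence of simple modules repeats an
    isomorphism class ([finitely_many_simples]), so the integers n_S are bounded. *)

Section LinearMaps.
Variable R : pzRingType.
Implicit Types M N P : lmodType R.

(** * Linear maps obtained by diagram chasing *)

Definition linmap M N (f : M -> N) (fP : linear f) : {linear M -> N} :=
  HB.pack f (GRing.isLinear.Build R M N *:%R f fP).

(** A diagram chase yields a linear relation that is total and single-valued; choice turns it into a
    function, and single-valuedness makes that function linear. *)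
Lemma linmap_of_rel M N (r : M -> N -> Prop) :
    (forall x, exists y, r x y) ->
    (forall x y y', r x y -> r x y' -> y = y') ->
    (forall a x x' y y', r x y -> r x' y' -> r (a *: x + x') (a *: y + y')) ->
  exists f : {linear M -> N}, forall x, r x (f x).
Proof.
move=> /choice[f fP] r_fun r_lin.
have f_lin : linear f.
  by move=> a x y; apply: r_fun (fP _) _; apply: r_lin; exact: fP.
by exists (linmap f_lin).
Qed.

Lemma factor_through_injection M N P (i : {linear N -> P}) (f : {linear M -> P}) :
    injective i -> (forall x, exists y, i y = f x) ->
  exists g : {linear M -> N}, forall x, i (g x) = f x.
Proof.
move=> i_inj imf; apply: (linmap_of_rel (r := fun x y => i y = f x)) => //.
- by move=> x y y' <- /i_inj.
- by move=> a x x' y y' e e'; rewrite !linearP e e'.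
Qed.

Lemma factor_through_surjection M N P (s : {linear M -> N}) (f : {linear M -> P}) :
    surjective_fun s -> (forall x, s x = 0 -> f x = 0) ->
  exists g : {linear N -> P}, forall x, g (s x) = f x.
Proof.
move=> s_surj kerf.
have [||| g gP] := @linmap_of_rel N P (fun y z => exists2 x, s x = y & f x = z).
- by move=> y; have [x xy] := s_surj y; exists (f x), x.
- move=> y z z' [x <- <-] [x' e <-]; apply/eqP; rewrite -subr_eq0 -linearB.
  by rewrite kerf // linearB e subrr.
- move=> a y y' z z' [x <- <-] [x' <- <-].
  by exists (a *: x + x'); rewrite linearP.
exists g => x; have [x' e <-] := gP (s x).
by apply/eqP; rewrite -subr_eq0 -linearB kerf // linearB e subrr.
Qed.

(** * Dual bases and finitely generated projectives *)

Definition dual_basis P k (phi : 'I_k -> dual P) (e : 'I_k -> P) : Prop :=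
  forall x, x = \sum_i (phi i x : R) *: e i.

(** By the dual basis lemma this is finitely generated projectivity, in a form that passes directly
    to duals and to the converse ring. *)
Definition has_dual_basis P : Prop :=
  exists k (phi : 'I_k -> dual P) (e : 'I_k -> P), dual_basis phi e.

Lemma sum_linear k P M (phi : 'I_k -> dual P) (m : 'I_k -> M) :
  linear (fun x => \sum_i (phi i x : R) *: m i).
Proof.
move=> a x y; rewrite scaler_sumr -big_split; apply: eq_bigr => i _ /=.
by rewrite linearP scalerDl scalerA.
Qed.

(** Only the images are compared, so maps into the kernel of an exact sequence lift without being
    corestricted first. *)
Lemma dual_basis_lift P M N (g : {linear M -> N}) (f : {linear P -> N}) :
    has_dual_basis P -> (forall x, exists y, g y = f x) ->
  exists h : {linear P -> M}, forall x, g (h x) = f x.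
Proof.
move=> [k [phi [e eP]]] imf.
have /choice[m mP] : forall i, exists y, g y = f (e i) by move=> i; exact: imf.
exists (linmap (sum_linear phi m)) => x /=.
by rewrite [in RHS](eP x) !linear_sum; apply: eq_bigr => i _; rewrite !linearZ mP.
Qed.

Lemma dual_basis_projective P : has_dual_basis P -> projective P.
Proof. by move=> hP M N g f g_surj; apply: dual_basis_lift => // x; exact: g_surj. Qed.

Definition coord_map n (i : 'I_n) (x : 'rV[R]_n) : R^o := x 0 i.
Lemma coord_map_linear n i : linear (@coord_map n i).
Proof. by move=> a x y; rewrite /coord_map !mxE. Qed.
Definition coord n (i : 'I_n) : dual 'rV[R]_n := linmap (@coord_map_linear n i).

Lemma rV_dual_basis n : dual_basis (@coord n) (fun i => delta_mx 0 i).
Proof. by move=> x; exact: row_sum_delta. Qed.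

Lemma rV_has_dual_basis n : has_dual_basis 'rV[R]_n.
Proof. by exists n, (@coord n), (fun i => delta_mx 0 i); exact: rV_dual_basis. Qed.

Lemma retract_has_dual_basis P M (i : {linear P -> M}) (r : {linear M -> P}) :
  (forall x, r (i x) = x) -> has_dual_basis M -> has_dual_basis P.
Proof.
move=> ri [k [phi [e eP]]].
exists k, (fun j => dual_map i (phi j)), (fun j => r (e j)) => x.
by rewrite -[LHS]ri {1}(eP (i x)) linear_sum; apply: eq_bigr => j _; rewrite linearZ.
Qed.

(** Projectivity splits the surjection from a free module, and a retract inherits the dual basis. *)
Lemma fp_projective_has_dual_basis P :
  finitely_presented P -> projective P -> has_dual_basis P.
Proof.
move=> [m [n [d [p [_ p_surj]]]]] /(_ _ _ p idfun p_surj)[h hP].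
exact: (retract_has_dual_basis hP (rV_has_dual_basis n)).
Qed.

(** P is the image of the idempotent i r of a free module, so the relations are the image of 1 - i
    r. *)
Lemma dual_basis_finitely_presented P : has_dual_basis P -> finitely_presented P.
Proof.
move=> [k [phi [e eP]]].
pose r := linmap (sum_linear (@coord k) e).
have i_lin : linear (fun x => \row_i (phi i x : R)).
  by move=> a x y; apply/rowP => i; rewrite !mxE linearP.
pose i := linmap i_lin.
have ri x : r (i x) = x.
  by rewrite [RHS]eP /=; apply: eq_bigr => j _; rewrite /= /coord_map mxE.
pose d : {linear 'rV[R]_k -> 'rV[R]_k} := idfun \- (i \o r).
exists k, k, (d), r; split=> [y|x]; last by exists (i x).
split=> [ry|[x <-]].
- by exists y; change (y - i (r y) = y); rewrite ry linear0 subr0.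
- by change (r (x - i (r x)) = 0); rewrite linearB ri subrr.
Qed.

End LinearMaps.

(** * Duals of modules with a dual basis *)

Section DualModules.
Variable R : pzRingType.
Implicit Types M N P Q : lmodType R.

Lemma dual_expand P k (phi : 'I_k -> dual P) (e : 'I_k -> P) (f : dual P) :
  dual_basis phi e -> f = \sum_i (f (e i) : R^c) *: phi i.
Proof.
move=> eP; apply: dualP => x.
have -> : forall r (F : 'I_k -> dual P),
    (\sum_(i <- r) F i : dual P) x = \sum_(i <- r) F i x.
  by move=> r F; elim/big_ind2: _ => // f1 x1 f2 x2 <- <-.
by rewrite {1}(eP x) linear_sum; apply: eq_bigr => i _; rewrite linearZ.
Qed.

Lemma dual_has_dual_basis P : has_dual_basis P -> has_dual_basis (dual P).
Proof.
move=> [k [phi [e eP]]]; exists k, (fun i => evaluation (e i)), phi => f.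
exact: dual_expand.
Qed.

Lemma dual_map_linear M N (d : {linear M -> N}) : linear (dual_map d).
Proof. by move=> a f g; apply: dualP. Qed.

(* Naturality of the isomorphism P^** -> P, Theta |-> sum_i Theta(phi_i) x_i. *)
Lemma dual_basis_natural P Q k (phi : 'I_k -> dual P) (x : 'I_k -> P)
    l (chi : 'I_l -> dual Q) (y : 'I_l -> Q)
    (g : {linear P -> Q}) (Theta : dual (dual P)) :
    dual_basis phi x -> dual_basis chi y ->
  \sum_j (Theta (dual_map g (chi j)) : R) *: y j =
  \sum_i (Theta (phi i) : R) *: g (x i).
Proof.
move=> xP yP.
transitivity (\sum_j \sum_i
    ((Theta (phi i) : R) * (chi j (g (x i)) : R)) *: y j).
  apply: eq_bigr => j _; rewrite -scaler_suml; congr (_ *: _).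
  rewrite {1}(dual_expand (dual_map g (chi j)) xP) linear_sum.
  by apply: eq_bigr => i _; rewrite linearZ.
rewrite exchange_big; apply: eq_bigr => i _ /=.
rewrite [in RHS](yP (g (x i))) scaler_sumr.
by apply: eq_bigr => j _; rewrite scalerA.
Qed.

End DualModules.

(** * Stably trivial maps *)

Section FiniteRank.
Variable R : pzRingType.
Implicit Types M N P Q : lmodType R.

(* Maps of this form are exactly those vanishing in the stable category. *)
Definition finite_rank M N (h : M -> N) : Prop :=
  exists k (phi : 'I_k -> dual M) (m : 'I_k -> N),
    forall x, h x = \sum_i (phi i x : R) *: m i.

Lemma finite_rank_ext M N (h h' : M -> N) :
  h =1 h' -> finite_rank h -> finite_rank h'.
Proof. by move=> hh' [k [phi [m hP]]]; exists k, phi, m => x; rewrite -hh'. Qed.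

Lemma finite_rank_add M N (h h' : M -> N) :
  finite_rank h -> finite_rank h' -> finite_rank (fun x => h x + h' x).
Proof.
move=> [k [phi [m hP]]] [l [psi [n h'P]]].
exists (k + l)%N,
  (fun i => match split i with inl j => phi j | inr j => psi j end),
  (fun i => match split i with inl j => m j | inr j => n j end) => x.
rewrite hP h'P big_split_ord; congr (_ + _); apply: eq_bigr => i _.
- by rewrite -/(unsplit (inl i)) unsplitK.
- by rewrite -/(unsplit (inr i)) unsplitK.
Qed.

Lemma finite_rank_compr M N P (h : N -> P) (g : {linear M -> N}) :
  finite_rank h -> finite_rank (fun x => h (g x)).
Proof.
by move=> [k [phi [m hP]]]; exists k, (fun i => dual_map g (phi i)), m => x.
Qed.

Lemma finite_rank_compl M N P (h : M -> N) (g : {linear N -> P}) :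
  finite_rank h -> finite_rank (fun x => g (h x)).
Proof.
move=> [k [phi [m hP]]]; exists k, phi, (fun i => g (m i)) => x.
by rewrite hP linear_sum; apply: eq_bigr => i _; rewrite linearZ.
Qed.

Lemma finite_rank_through M N P (a : {linear M -> P}) (b : {linear P -> N}) :
  has_dual_basis P -> finite_rank (fun x => b (a x)).
Proof.
move=> [k [phi [e eP]]].
have idP : finite_rank (fun x : P => x) by exists k, phi, e.
exact: (finite_rank_compr a (finite_rank_compl b idP)).
Qed.

Lemma finite_rank_lift M N P (h : M -> N) (p : {linear P -> N}) :
    surjective_fun p -> finite_rank h ->
  exists h' : {linear M -> P}, (forall x, p (h' x) = h x).
Proof.
move=> p_surj [k [phi [m hP]]].
have /choice[m' m'P] : forall i, exists y, p y = m i by move=> i; exact: p_surj.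
exists (linmap (sum_linear phi m')) => x.
by rewrite hP linear_sum; apply: eq_bigr => i _; rewrite linearZ m'P.
Qed.

Definition free_fpmod n : fpmod R :=
  FPMod (dual_basis_finitely_presented (rV_has_dual_basis R n)).

Lemma free_fpmod_projective n : projective (free_fpmod n).
Proof. exact/dual_basis_projective/rV_has_dual_basis. Qed.

Lemma stable_eq_of_finite_rank (M N : fpmod R) (f g : {linear M -> N}) :
  finite_rank (fun x => f x - g x) -> stable_eq f g.
Proof.
move=> [k [phi [m fgP]]].
have a_lin : linear (fun x => \row_i (phi i x : R)).
  by move=> a x y; apply/rowP => i; rewrite !mxE linearP.
exists (free_fpmod k), (linmap a_lin), (linmap (sum_linear (@coord R k) m)).
split=> [|x]; first exact: free_fpmod_projective.
by rewrite fgP; apply: eq_bigr => i _; rewrite /= /coord_map mxE.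
Qed.

End FiniteRank.

(** * One step of the adjunction between Sigma and Omega *)

Section Adjunction.
Variable R : pzRingType.
Implicit Types K L M N X Y Z : fpmod R.

(* A weak form of: K -> F -> X -> 0 is exact and K -> F is a left             *)
(* approximation by projectives. The strong form holds only up to projective  *)
(* summands when X is a value of Sigma K for arbitrary presentations. Here    *)
(* G -> F -> X is exact, the approximation property holds for maps that       *)
(* factor through beta : G -> K, and beta gamma agrees with p : P0 -> K up to *)
(* the map p nu : K -> K, which factors through a projective.                 *)
Definition cosyzygy_data K X : Prop :=
  exists (F P0 G : lmodType R) (s : {linear F -> X}) (f : {linear G -> F})
         (kappa : {linear K -> F}) (p : {linear P0 -> K})
         (beta : {linear G -> K}) (gamma : {linear P0 -> G})
         (nu : {linear K -> P0}),
    [/\ [/\ has_dual_basis F, has_dual_basis P0, surjective_fun s & surjective_fun p],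
        exact_at f s /\ forall x, s (kappa x) = 0,
        forall x, kappa (p x) = f (gamma x),
        forall x, beta (gamma x) = p x + p (nu (p x)) &
        forall (Q : lmodType R) (g : {linear K -> Q}), has_dual_basis Q ->
          exists w : {linear F -> Q}, forall x, w (f x) = g (beta x)].

(** Here t is the adjoint of u. A stable factorization of t through Z yields one of u through a
    syzygy of Z. Since t is fixed before Z and Y, hypothesis and conclusion have the same shape and
    the lemma can be iterated. *)
Lemma cosyzygy_syzygy_adjunction K X M L (u : {linear K -> L}) :
    cosyzygy_data K X -> is_syzygy M L ->
  exists t : {linear X -> M}, forall Z Y, is_syzygy Z Y ->
    forall (g : {linear X -> Z}) (h : {linear Z -> M}),
      finite_rank (fun x => h (g x) - t x) ->
    exists (g' : {linear K -> Y}) (h' : {linear Y -> L}),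
      finite_rank (fun x => h' (g' x) - u x).
Proof.
move=> [F [P0 [G [s [f [kappa [p [beta [gamma [nu]]]]]]]]]].
move=> [[F_proj P0_proj s_surj p_surj] [fs_exact s_kappa] kappa_p beta_gamma ext].
move=> [P [i [pi [P_proj i_inj i_pi pi_surj]]]].
have P_dual := fp_projective_has_dual_basis (fpmodP P) P_proj.
(* The approximation property carries i u to a map w on F, which induces t on the cokernel X. *)
have [w wP] := ext P (i \o u : {linear K -> P}) P_dual.
have [t tP] : exists t : {linear X -> M}, forall x, t (s x) = pi (w x).
  have [|t tP] := @factor_through_surjection _ _ _ _ s (pi \o w) s_surj.
    by move=> x /fs_exact[y <-] /=; rewrite wP /=; apply/i_pi; exists (u (beta y)).
  by exists t.
exists t => Z Y [P' [i' [pi' [P'_proj i'_inj i'_pi' pi'_surj]]]] g h hg_t.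
have P'_dual := fp_projective_has_dual_basis (fpmodP P') P'_proj.
(* Lift g to the projectives; restricting the lift along [kappa] gives g', since s kills the image
   of [kappa]. *)
have [w' w'P] : exists w' : {linear F -> P'}, forall x, pi' (w' x) = g (s x).
  have [|w' w'P] := @dual_basis_lift _ _ _ _ pi' (g \o s) F_proj.
    by move=> x; exact: pi'_surj.
  by exists w'.
have [g' g'P] : exists g' : {linear K -> Y}, forall x, i' (g' x) = w' (kappa x).
  have [|g' g'P] := @factor_through_injection _ _ _ _ i' (w' \o kappa) i'_inj.
    by move=> x; apply/i'_pi'; rewrite /= w'P s_kappa linear0.
  by exists g'.
have [j jP] : exists j : {linear P' -> P}, forall x, pi (j x) = h (pi' x).
  have [|j jP] := @dual_basis_lift _ _ _ _ pi (h \o pi') P'_dual.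
    by move=> x; exact: pi_surj.
  by exists j.
have [h' h'P] : exists h' : {linear Y -> L}, forall x, i (h' x) = j (i' x).
  have [|h' h'P] := @factor_through_injection _ _ _ _ i (j \o i') i_inj.
    move=> x; apply/i_pi; rewrite /= jP.
    by have -> : pi' (i' x) = 0 by [apply/i'_pi'; exists x]; rewrite linear0.
  by exists h'.
exists g', h'.
have [v vP] := finite_rank_lift pi_surj hg_t.
(* [pi] kills j w' - w - v s, because v lifts the stably trivial difference h g - t; hence this map
   lands in L. *)
have [c cP] : exists c : {linear F -> L}, forall x,
    i (c x) = j (w' x) - w x - v (s x).
  have [|c cP] := @factor_through_injection _ _ _ _ i
      ((j \o w') \- w \- (v \o s)) i_inj.
    move=> x; apply/i_pi; rewrite /= !linearB /= jP w'P -tP vP.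
    by rewrite subrr.
  by exists c.
(* This sum equals h' g' - u: the first term comes from the defect of beta gamma, the second from
   the discrepancy of the lifts. *)
have fr : finite_rank (fun x => u (p (nu x)) + c (kappa x)).
  apply: finite_rank_add.
  - exact: (finite_rank_through nu (u \o p) P0_proj).
  - exact: (finite_rank_through kappa c F_proj).
apply: finite_rank_ext fr => x; apply: i_inj.
rewrite linearD cP linearB h'P g'P s_kappa linear0 subr0.
have [y <-] := p_surj x.
by rewrite kappa_p wP /= beta_gamma !linearD /= addrC -addrA subrK.
Qed.

End Adjunction.

(* The inverse of ccmod. *)
Definition uncc (R : pzRingType) (M : lmodType R^c^c) : Type := M.

(** * Modules over the converse of the converse ring *)

Section Uncc.
Variable R : pzRingType.

Section Module.
Variable M : lmodType R^c^c.

HB.instance Definition _ := GRing.Zmodule.on (uncc M).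

Definition uncc_scale (a : R) (x : uncc M) : uncc M := (a : R^c^c) *: (x : M).

Lemma uncc_scaleA a b x : uncc_scale a (uncc_scale b x) = uncc_scale (a * b) x.
Proof. exact: (@scalerA R^c^c M). Qed.
Lemma uncc_scale1 : left_id 1 uncc_scale.
Proof. exact: (@scale1r R^c^c M). Qed.
Lemma uncc_scaleDr : right_distributive uncc_scale +%R.
Proof. by move=> a x y; exact: (@scalerDr R^c^c M). Qed.
Lemma uncc_scaleDl x : {morph uncc_scale^~ x : a b / a + b}.
Proof. by move=> a b; exact: (@scalerDl R^c^c M). Qed.

HB.instance Definition _ :=
  GRing.Zmodule_isLmodule.Build R (uncc M)
    uncc_scaleA uncc_scale1 uncc_scaleDr uncc_scaleDl.

Lemma uncc_has_dual_basis :
  has_dual_basis M -> has_dual_basis (uncc M : lmodType R).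
Proof.
move=> [k [phi [e eP]]].
have phi_lin i : linear (phi i : uncc M -> R^o).
  by move=> a x y; exact: (linearP (phi i) (a : R^c^c)).
by exists k, (fun i => linmap (phi_lin i)), e.
Qed.

End Module.

Lemma uncc_linear (M N : lmodType R^c^c) (f : {linear M -> N}) :
  linear (f : uncc M -> uncc N).
Proof. by move=> a x y; exact: (linearP f (a : R^c^c)). Qed.

Lemma uncc_ccmod_linear (M : lmodType R^c^c) (N : lmodType R)
  (f : {linear M -> ccmod N}) : linear (f : uncc M -> N).
Proof. by move=> a x y; exact: (linearP f (a : R^c^c)). Qed.

End Uncc.

(** * The complex underlying a value of Sigma *)

Section Sigma.
Variable R : pzRingType.
Implicit Types K X : fpmod R.

(* The complex is Q0^* -> Q1^* -> X, where Q1 -> Q0 -> Omega Tr K is the      *)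
(* presentation that defines X; c0 and c1 compare it with P0^* -> P1^*.       *)
Lemma sigma_cosyzygy_data K X : is_sigma K X -> cosyzygy_data K X.
Proof.
move=> [T [K' []]].
move=> [P1 [P0 [d [p [q [P1_proj P0_proj [d_p p_surj] [d_q q_surj]]]]]]].
move=> [P [i [pi [P_proj i_inj i_pi pi_surj]]]].
move=> [Q1 [Q0 [e [r [s [Q1_proj Q0_proj [e_r r_surj] [e_s s_surj]]]]]]].
have P1_dual := fp_projective_has_dual_basis (fpmodP P1) P1_proj.
have P0_dual := fp_projective_has_dual_basis (fpmodP P0) P0_proj.
have P_dual := fp_projective_has_dual_basis (fpmodP P) P_proj.
have Q1_dual := fp_projective_has_dual_basis (fpmodP Q1) Q1_proj.
have Q0_dual := fp_projective_has_dual_basis (fpmodP Q0) Q0_proj.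
pose dt := linmap (dual_map_linear d).
(* Both P and the dual of P1 are projective and map onto T; a and b compare them over T. *)
have [a aP] : exists a : {linear dual P1 -> P}, forall x, pi (a x) = q x.
  apply: dual_basis_lift => [|x]; first exact: dual_has_dual_basis.
  exact: pi_surj.
have [b bP] : exists b : {linear P -> dual P1}, forall x, q (b x) = pi x.
  by apply: dual_basis_lift => // x; exact: q_surj.
have [c0 c0P] : exists c0 : {linear dual P0 -> Q0},
    forall x, i (r (c0 x)) = a (dt x).
  have [||c0 c0P] := @dual_basis_lift _ _ _ _ (i \o r) (a \o dt).
  - exact: dual_has_dual_basis.
  - move=> x; have /i_pi[y yP] : pi (a (dt x)) = 0.
      by rewrite aP; apply/d_q; exists x.
    by have [z zP] := r_surj y; exists z; rewrite /= zP.
  - by exists c0.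
have [c1 c1P] : exists c1 : {linear Q0 -> dual P0},
    forall x, dt (c1 x) = b (i (r x)).
  have [||c1 c1P] := @dual_basis_lift _ _ _ _ dt (b \o i \o r).
  - exact: Q0_dual.
  - by move=> x; apply/d_q; rewrite /= bP; apply/i_pi; exists (r x).
  - by exists c1.
(* Since b a and the identity agree over T, they differ by a map through [dt]. *)
have [rho rhoP] : exists rho : {linear dual P1 -> dual P0},
    forall x, dt (rho x) = b (a x) - x.
  have [||rho rhoP] := @dual_basis_lift _ _ _ _ dt ((b \o a) \- idfun).
  - exact: dual_has_dual_basis.
  - by move=> x; apply/d_q; rewrite /= linearB bP aP subrr.
  - by exists rho.
have [k [phi [x0 x0P]]] := P0_dual.
(* [dt] kills c1 c0 - 1 - rho dt, so each of its values is a functional on P0 that vanishes on the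
   image of d and descends to K. *)
have /choice[nu_ nu_P] : forall j, exists nu : dual K, forall x,
    c1 (c0 (phi j)) x = phi j x + rho (dt (phi j)) x + nu (p x).
  move=> j; pose n := c1 (c0 (phi j)) - (phi j + rho (dt (phi j))).
  have dn : dt n = 0.
    by rewrite linearB linearD c1P c0P rhoP addrC [dt _ + _]addrC subrK addNr.
  have [||nu nuP] := @factor_through_surjection _ _ _ _ p n.
  - exact: p_surj.
  - move=> x /d_p[y <-]; exact: (congr1 (fun f : dual P1 => f y) dn).
  - exists nu => x; rewrite nuP /=.
    by change (c1 (c0 (phi j)) x = phi j x + rho (dt (phi j)) x +
      (c1 (c0 (phi j)) x - (phi j x + rho (dt (phi j)) x))); rewrite addrC subrK.
pose G : lmodType R := uncc (dual Q0).
pose F : lmodType R := uncc (dual Q1).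
have e_lin := uncc_linear (linmap (dual_map_linear e)).
pose f : {linear G -> F} := linmap e_lin.
pose s' : {linear F -> X} := linmap (uncc_ccmod_linear s).
(* [gamma] is the canonical map from P0 to its bidual followed by the transpose of c1. *)
have gamma_lin : linear (fun x => dual_map c1 (evaluation x) : G).
  move=> t x y; apply: dualP => z.
  exact: (linearP (c1 z) t).
pose gamma : {linear P0 -> G} := linmap gamma_lin.
have [kappa kappaP] : exists kappa : {linear K -> F}, forall x,
    kappa (p x) = f (gamma x).
  have [||kappa kappaP] := @factor_through_surjection _ _ _ _ p (f \o gamma).
  - exact: p_surj.
  - move=> x /d_p[y <-]; apply: dualP => z.
    change (dt (c1 (e z)) y = 0); rewrite c1P.
    have -> : r (e z) = 0 by apply/e_r; exists z.
    by rewrite !linear0.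
  - by exists kappa.
(* [beta] is the transpose of c0, then the identification of the bidual of P0 with P0 written in the
   dual basis, then p. *)
have beta_lin : linear (fun psi : G => \sum_j (psi (c0 (phi j)) : R) *: p (x0 j)).
  move=> t psi psi'; rewrite scaler_sumr -big_split; apply: eq_bigr => j _ /=.
  by rewrite scalerA -scalerDl.
pose beta : {linear G -> K} := linmap beta_lin.
pose nu : {linear K -> P0} := linmap (sum_linear nu_ x0).
have sf x : s' (f x) = 0 by apply/e_s; exists x.
exists F, P0, G, s', f, kappa, p, beta, gamma, nu; split.
- split=> //; exact/uncc_has_dual_basis/dual_has_dual_basis.
- split=> [y|x]; first exact: e_s.
  by have [y <-] := p_surj x; rewrite kappaP.
- exact: kappaP.
- move=> x /=.
  have px : p x = \sum_j (phi j x : R) *: p (x0 j).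
    by rewrite {1}(x0P x) linear_sum; apply: eq_bigr => j _; rewrite linearZ.
    rewrite [X in _ = X + _]px linear_sum -big_split /=.
  (* By naturality for d, this sum is the image under p d of an element of P1. *)
  have rho0 : \sum_j (rho (dt (phi j)) x : R) *: p (x0 j) = 0.
    have [l [theta [z zP]]] := P1_dual.
    transitivity (p (\sum_j (rho (dt (phi j)) x : R) *: x0 j)).
      by rewrite linear_sum; apply: eq_bigr => j _; rewrite linearZ.
    have := dual_basis_natural d (dual_map rho (evaluation x)) zP x0P.
    rewrite /= => ->; rewrite linear_sum big1 // => j _; rewrite linearZ.
    have -> : p (d (z j)) = 0 by apply/d_p; exists (z j).
    by rewrite /= scaler0.
  rewrite -[RHS]addr0 -[X in _ = _ + X]rho0 -big_split /=; apply: eq_bigr => j _.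
  rewrite linearZ -!scalerDl; congr (_ *: _).
  by rewrite -addrA [nu_ j _ + _]addrC addrA; exact: nu_P.
move=> Q g [l [chi [y yP]]].
(* The extension is built dually: c0 after the transpose of g p is killed by r, so it lifts through
   e to [mu]; transposing [mu] and identifying Q with its bidual gives the required map. *)
have [mu muP] : exists mu : {linear dual Q -> Q1}, forall h,
    e (mu h) = c0 (dual_map (g \o p : {linear P0 -> Q}) h).
  have [||mu muP] := @dual_basis_lift _ _ _ _ e
     (c0 \o linmap (dual_map_linear (g \o p : {linear P0 -> Q}))).
  - by apply: dual_has_dual_basis; exists l, chi, y.
  - move=> h; apply/e_r; apply: i_inj; rewrite linear0 c0P.
    rewrite [dt _](_ : _ = 0) ?linear0 //; apply: dualP => z /=.
    have -> : p (d z) = 0 by apply/d_p; exists z.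
    by rewrite !linear0.
  - by exists mu.
have w_lin : linear (fun eta : F => \sum_j (eta (mu (chi j)) : R) *: y j).
  move=> t eta eta'; rewrite scaler_sumr -big_split; apply: eq_bigr => j _ /=.
  by rewrite scalerA -scalerDl.
exists (linmap w_lin) => psi.
transitivity (\sum_j
    (psi (c0 (dual_map (g \o p : {linear P0 -> Q}) (chi j))) : R) *: y j).
  by apply: eq_bigr => j _; rewrite -muP.
rewrite (dual_basis_natural (g \o p) (dual_map c0 psi) x0P yP) /= linear_sum.
by apply: eq_bigr => j _; rewrite linearZ.
Qed.

End Sigma.

(** * The iterated adjunction *)

Lemma iter_relSl (T : Type) (r : T -> T -> Prop) n x y :
  iter_rel r n.+1 x y <-> exists z, r x z /\ iter_rel r n z y.
Proof.
elim: n y => [|n IHn] y.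
  by split=> [[z [<- xy]]|[z [xz <-]]]; [exists y | exists x].
split=> [[z [/IHn[w [xw wz]] zy]]|[w [xw [z [wz zy]]]]].
- by exists w; split=> //; exists z.
- by exists z; split=> //; apply/IHn; exists w.
Qed.

Section IteratedAdjunction.
Variable R : pzRingType.
Implicit Types K L M N X Y Z : fpmod R.

(** The first Sigma step, out of K, is paired with the last Omega step, into L; the resulting
    adjoint K1 -> M1 is then passed to the induction hypothesis. *)
Lemma iter_sigma_syzygy_adjunction n K X M L (u : {linear K -> L}) :
    iter_rel (@is_sigma R) n K X -> iter_rel (@is_syzygy R) n M L ->
  exists t : {linear X -> M}, forall Z Y, iter_rel (@is_syzygy R) n Z Y ->
    forall (g : {linear X -> Z}) (h : {linear Z -> M}),
      finite_rank (fun x => h (g x) - t x) ->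
    exists (g' : {linear K -> Y}) (h' : {linear Y -> L}),
      finite_rank (fun x => h' (g' x) - u x).
Proof.
elim: n K L u => [|n IHn] K L u.
  by move=> /= eKX eML; subst X L; exists u => Z _ <- g h ght; exists g, h.
move=> /iter_relSl[K1 [/sigma_cosyzygy_data KK1 K1X]] [M1 [MM1 M1L]].
have [t1 t1P] := cosyzygy_syzygy_adjunction u KK1 M1L.
have [t tP] := IHn _ _ t1 K1X MM1.
exists t => Z Y [Y1 [ZY1 Y1Y]] g h /(tP _ _ ZY1)[g1 [h1]].
exact: t1P Y1Y g1 h1.
Qed.

(* The triangle identity for the adjunction between Sigma^n and Omega^n. *)
Lemma syzygy_stable_retract n M K X Y :
    iter_rel (@is_syzygy R) n M K -> iter_rel (@is_sigma R) n K X ->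
    iter_rel (@is_syzygy R) n X Y ->
  stable_retract K Y.
Proof.
move=> MK KX XY.
have [t tP] := iter_sigma_syzygy_adjunction (idfun : {linear K -> K}) KX MK.
(* The adjoint t of the identity of K factors through X itself, as t after the identity. *)
have [|g [h ghP]] := tP X Y XY idfun t.
  exists 0, (fun=> 0), (fun=> 0) => x.
  by rewrite big_ord0 subrr.
by exists g, h; exact: stable_eq_of_finite_rank.
Qed.

End IteratedAdjunction.

(** * Quotient modules *)

Section QuotientModule.
Variables (R : pzRingType) (M : lmodType R) (U : M -> Prop).

(** The proof is an argument so that the closure instance can be attached to the predicate. *)
Definition submodule_pred (hU : submodule U) : {pred M} := fun x => `[< U x >].

Variable hU : submodule U.
Local Notation I := (submodule_pred hU).

Lemma submodule_pred_zmod_closed : zmod_closed I.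
Proof.
have [U0 UD UZ] := hU; split=> [|x y]; first exact/asboolP.
move=> /asboolP Ux /asboolP Uy; apply/asboolP.
by rewrite -scaleN1r; apply: UD => //; exact: UZ.
Qed.

HB.instance Definition _ :=
  GRing.isZmodClosed.Build M I submodule_pred_zmod_closed.

Definition quotient_module : Type := {ideal_quot I}.
HB.instance Definition _ := GRing.Zmodule.on quotient_module.

Definition to_quotient (x : M) : quotient_module := (\pi_({ideal_quot I}) x)%qT.

Lemma to_quotient_eq x y : to_quotient x = to_quotient y <-> U (x - y).
Proof.
split=> [/eqP|Uxy]; first by rewrite -Quotient.idealrBE => /asboolP.
by apply/eqP; rewrite -Quotient.idealrBE; exact/asboolP.
Qed.

Lemma to_quotientD x y : to_quotient (x + y) = to_quotient x + to_quotient y.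
Proof. by rewrite /to_quotient raddfD. Qed.

Definition quotient_scale (a : R) (q : quotient_module) : quotient_module :=
  to_quotient (a *: repr (q : {ideal_quot I})).

Lemma quotient_scale_pi a x :
  quotient_scale a (to_quotient x) = to_quotient (a *: x).
Proof.
apply/to_quotient_eq; rewrite -scalerBr.
have [_ _ UZ] := hU; apply/UZ/to_quotient_eq.
exact: reprK.
Qed.

Lemma to_quotient_surj : surjective_fun to_quotient.
Proof. by move=> q; exists (repr (q : {ideal_quot I})); exact: reprK. Qed.

Lemma quotient_scaleA a b x :
  quotient_scale a (quotient_scale b x) = quotient_scale (a * b) x.
Proof. by have [y <-] := to_quotient_surj x; rewrite !quotient_scale_pi scalerA. Qed.
Lemma quotient_scale1 : left_id 1 quotient_scale.
Proof.
by move=> x; have [y <-] := to_quotient_surj x; rewrite quotient_scale_pi scale1r.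
Qed.
Lemma quotient_scaleDr : right_distributive quotient_scale +%R.
Proof.
move=> a x y; have [x' <-] := to_quotient_surj x.
have [y' <-] := to_quotient_surj y.
by rewrite -to_quotientD !quotient_scale_pi scalerDr to_quotientD.
Qed.
Lemma quotient_scaleDl x : {morph quotient_scale^~ x : a b / a + b}.
Proof.
move=> a b; have [x' <-] := to_quotient_surj x.
by rewrite !quotient_scale_pi scalerDl to_quotientD.
Qed.

HB.instance Definition _ :=
  GRing.Zmodule_isLmodule.Build R quotient_module
    quotient_scaleA quotient_scale1 quotient_scaleDr quotient_scaleDl.

Lemma to_quotient_linear : linear to_quotient.
Proof. by move=> a x y; rewrite to_quotientD -quotient_scale_pi. Qed.

End QuotientModule.

Lemma quotient_exists (R : pzRingType) (M : lmodType R) (U : M -> Prop) :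
    submodule U ->
  exists (Q : lmodType R) (q : {linear M -> Q}),
    surjective_fun q /\ forall x, q x = 0 <-> U x.
Proof.
move=> hU; exists (quotient_module hU), (linmap (to_quotient_linear hU)).
split=> [|x]; first exact: to_quotient_surj.
have e0 : (0 : quotient_module hU) = to_quotient hU 0.
  by symmetry; exact: (linear0 (linmap (to_quotient_linear hU))).
by rewrite e0 -[x in U x]subr0; exact: to_quotient_eq.
Qed.

(** * Finite generation and existence of syzygies *)

Section FinitelyGenerated.
Variable R : pzRingType.
Implicit Types M N : lmodType R.

Lemma image_submodule M N (f : {linear M -> N}) :
  submodule (fun y => exists x, f x = y).
Proof.
split=> [|x y [x' <-] [y' <-]|a x [x' <-]].
- by exists 0; rewrite linear0.
- by exists (x' + y'); rewrite linearD.
- by exists (a *: x'); rewrite linearZ.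
Qed.

Lemma kernel_submodule M N (f : {linear M -> N}) : submodule (fun x => f x = 0).
Proof.
split=> [|x y fx fy|a x fx]; first exact: linear0.
- by rewrite linearD fx fy addr0.
- by rewrite linearZ fx /= scaler0.
Qed.

Definition finitely_generated M (U : M -> Prop) : Prop :=
  exists k (d : {linear 'rV[R]_k -> M}), forall y, U y <-> exists x, d x = y.

Lemma row_map_linear M k l (d : {linear 'rV[R]_k -> M}) (d' : {linear 'rV[R]_l -> M}) :
  linear (fun z : 'rV[R]_(k + l) => d (lsubmx z) + d' (rsubmx z)).
Proof. by move=> a x y; rewrite !linearP scalerDr addrACA. Qed.

Definition row_map M k l (d : {linear 'rV[R]_k -> M}) (d' : {linear 'rV[R]_l -> M}) :
  {linear 'rV[R]_(k + l) -> M} := linmap (row_map_linear d d').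

Lemma row_mapE M k l (d : {linear 'rV[R]_k -> M}) (d' : {linear 'rV[R]_l -> M}) x y :
  row_map d d' (row_mx x y) = d x + d' y.
Proof. by rewrite /= row_mxKl row_mxKr. Qed.

(** Lifts to U of generators of f(U), together with generators of the part of U in the kernel,
    generate U. *)
Lemma finitely_generated_extension M N (f : {linear M -> N}) (U : M -> Prop) :
    submodule U -> finitely_generated (fun y => exists2 x, U x & f x = y) ->
    finitely_generated (fun x => U x /\ f x = 0) ->
  finitely_generated U.
Proof.
move=> [U0 UD UZ] [k [d dP]] [l [d' d'P]].
have /choice[m mP] : forall i, exists x, U x /\ f x = d (delta_mx 0 i).
  by move=> i; have [|x Ux fx] := (dP (d (delta_mx 0 i))).2; [eexists | exists x].
pose e := linmap (sum_linear (@coord R k) m).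
have Ue x : U (e x).
  rewrite /=; elim/big_ind: _ => // i _; apply: UZ; exact: (mP i).1.
have fe x : f (e x) = d x.
  rewrite [in RHS](row_sum_delta x) !linear_sum; apply: eq_bigr => i _.
  by rewrite !linearZ (mP i).2.
exists (k + l)%N, (row_map e d') => y; split=> [Uy|[x <-]]; last first.
  by apply: UD => //; have [|] := (d'P (d' (rsubmx x))).2; first by eexists.
have [|x xP] := (dP (f y)).1; first by exists y.
have [|x' x'P] := (d'P (y - e x)).1.
  split; first by rewrite -scaleN1r; apply: UD => //; exact: UZ.
  by rewrite linearB fe xP subrr.
by exists (row_mx x x'); rewrite row_mapE x'P addrC subrK.
Qed.

(** Otherwise every finite family in U misses some element of U, and adjoining such elements one at
    a time gives a strictly increasing chain. An element of [St] is such a family, encoded as a map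
    from a free module. *)
Lemma acc_finitely_generated (U : R^o -> Prop) :
  ascending_chain_condition (@left_ideal R) -> submodule U -> finitely_generated U.
Proof.
move=> acc [U0 UD UZ]; apply: contrapT => nfg.
pose St := {d : {k & {linear 'rV[R]_k -> R^o}} | forall x, U (tagged d x)}.
pose im (s : St) y := exists x, tagged (sval s) x = y.
have /choice[next nextP] : forall s : St, exists s' : St,
    (forall y, im s y -> im s' y) /\ ~ (forall y, im s' y -> im s y).
  move=> [[k d] /= dU].
  have [y Uy ndy] : exists2 y, U y & ~ exists x, d x = y.
    apply: contrapT => h; apply: nfg; exists k, d => y.
    split=> [Uy|[x <-]//]; apply: contrapT => ndy; apply: h.
    by exists y.
  pose g := linmap (sum_linear (@coord R 1) (fun=> y)).
  have gU x : U (row_map d g x).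
    by apply: UD => //=; rewrite big_ord1; exact: UZ.
  have g1 : g 1%:M = y by rewrite /= big_ord1 /= /coord_map mxE eqxx scale1r.
  exists (exist _ (existT _ (k + 1)%N (row_map d g)) gU); split.
    by move=> z [x <-]; exists (row_mx x 0);
      rewrite -[LHS]/(row_map d g _) row_mapE linear0 addr0.
  apply/existsNP; exists y => h; apply: ndy; apply: h.
  by exists (row_mx 0 1%:M); rewrite -[LHS]/(row_map d g _) row_mapE linear0 g1 add0r.
have s0U x : U ((\0 : {linear 'rV[R]_0 -> R^o}) x) by exact: U0.
pose s0 : St := exist _ (existT _ 0%N (\0 : {linear 'rV[R]_0 -> R^o})) s0U.
have [||n nP] := acc (fun n => im (iter n next s0)).
- move=> n; have [] := image_submodule (tagged (sval (iter n next s0))).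
  by split.
- by move=> n x; exact: (nextP _).1.
by apply: (nextP (iter n next s0)).2 => y; exact: (nP n.+1).
Qed.

(** Induction on the number j of leading coordinates allowed to be nonzero; projection to the last
    of these has an ideal as image and the previous case as kernel. *)
Lemma acc_finitely_generated_rV n (U : 'rV[R]_n -> Prop) :
  ascending_chain_condition (@left_ideal R) -> submodule U -> finitely_generated U.
Proof.
move=> acc; suff: forall j, (j <= n)%N -> forall U : 'rV[R]_n -> Prop, submodule U ->
    (forall x, U x -> forall i : 'I_n, (j <= i)%N -> x 0 i = 0) -> finitely_generated U.
  move=> /(_ n (leqnn n)) h hU; apply: (h U) => // x _ i.
  by rewrite leqNgt ltn_ord.
elim=> [|j IHj] jn {}U hU Uj; have [U0 UD UZ] := hU.
  exists 0, (\0 : {linear 'rV[R]_0 -> 'rV[R]_n}) => y; split=> [Uy|[x <-]//].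
  by exists 0; apply/rowP => i; rewrite mxE (Uj y).
apply: (@finitely_generated_extension _ _ (coord R (Ordinal jn))) => //.
- apply: acc_finitely_generated => //.
  split=> [|_ _ [x Ux <-] [y Uy <-]|a _ [x Ux <-]].
  + by exists 0 => //; rewrite linear0.
  + by exists (x + y); [exact: UD | rewrite linearD].
  + by exists (a *: x); [exact: UZ | rewrite linearZ].
- apply: (IHj (ltnW jn)).
  + have [K0 KD KZ] := kernel_submodule (coord R (Ordinal jn)).
    split; first by split.
    * by move=> x y [Ux x0] [Uy y0]; split; [exact: UD | exact: KD].
    * by move=> a x [Ux x0]; split; [exact: UZ | exact: KZ].
  + move=> x [Ux x0] i; rewrite leq_eqVlt => /predU1P[ji|]; last exact: Uj.
    by rewrite -[RHS]x0 /= /coord_map; congr (x 0 _); exact: val_inj.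
Qed.

(** The kernel of p is the image of d, that is, a free module modulo the kernel of d, which is
    finitely generated by the chain condition. *)
Lemma syzygy_exists (X : fpmod R) :
  ascending_chain_condition (@left_ideal R) -> exists K : fpmod R, is_syzygy X K.
Proof.
move=> acc; have [m [n [d [p [d_p p_surj]]]]] := fpmodP X.
have [l [c cP]] := acc_finitely_generated_rV acc (kernel_submodule d).
have [Q [q [q_surj qP]]] := quotient_exists (kernel_submodule d).
have Qfp : finitely_presented Q.
  exists l, m, c, q; split=> // y.
  by split=> [/qP/cP//|/cP/qP].
have [i iP] := factor_through_surjection q_surj (fun x => (qP x).1).
exists (FPMod Qfp), (free_fpmod R n), i, p; split=> //.
- exact: free_fpmod_projective.
- move=> x y; have [x' <-] := q_surj x; have [y' <-] := q_surj y.
  rewrite !iP => e; apply/eqP; rewrite -subr_eq0 -linearB; apply/eqP/qP.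
  by rewrite linearB e subrr.
- move=> y; split=> [/d_p[x <-]|[x <-]]; first by exists (q x).
  by have [x' <-] := q_surj x; rewrite iP; apply/d_p; exists x'.
Qed.

Lemma iter_syzygy_exists n (X : fpmod R) :
  ascending_chain_condition (@left_ideal R) ->
  exists K, iter_rel (@is_syzygy R) n X K.
Proof.
move=> acc; elim: n => [|n [K XK]]; first by exists X.
by have [K' KK'] := syzygy_exists K acc; exists K', K.
Qed.

(** The cokernel of j is finitely presented because X is finitely generated. *)
Lemma embedded_is_syzygy (X : fpmod R) m (j : {linear X -> 'rV[R]_m}) :
  injective j -> exists N : fpmod R, is_syzygy N X.
Proof.
move=> j_inj; have [k [n [_ [p [_ p_surj]]]]] := fpmodP X.
have [Q [q [q_surj qP]]] := quotient_exists (image_submodule j).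
have Qfp : finitely_presented Q.
  exists n, m, (j \o p : {linear 'rV[R]_n -> 'rV[R]_m}), q; split=> // y.
  split=> [/qP[x <-]|[x <-]]; last by apply/qP; exists (p x).
  by have [z <-] := p_surj x; exists z.
exists (FPMod Qfp), (free_fpmod R m), j, q; split=> //.
exact: free_fpmod_projective.
Qed.

End FinitelyGenerated.

(** * Torsionfree modules are syzygies *)

Section Torsionfree.
Variable R : pzRingType.

(** A functional is determined by its values at the n generators of X, so the dual is a submodule of
    a free module over [R^c], where the chain condition applies. *)
Lemma dual_finitely_generated (X : fpmod R) :
    ascending_chain_condition (@left_ideal R^c) ->
  exists m (f : 'I_m -> dual X), forall g : dual X,
    exists c : 'I_m -> R, forall x, g x = \sum_l (f l x : R) * c l.
Proof.
move=> acc; have [k [n [_ [p [_ p_surj]]]]] := fpmodP X.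
have D_lin : linear (fun g : dual X => \row_i (g (p (delta_mx 0 i)) : R^c)).
  by move=> a g h; apply/rowP => i; rewrite !mxE.
pose D := linmap D_lin.
have [m [d dP]] := acc_finitely_generated_rV acc (image_submodule D).
have /choice[f fP] : forall l : 'I_m, exists f : dual X, D f = d (delta_mx 0 l).
  by move=> l; apply/dP; eexists.
exists m, f => g.
have /dP[c cP] : exists x, D x = D g by exists g.
exists (fun l => c 0 l) => x; have [y <-] := p_surj x.
have gE i : g (p (delta_mx 0 i)) = \sum_l (f l (p (delta_mx 0 i)) : R) * c 0 l.
  have := congr1 (fun v : 'rV[R^c]_n => v 0 i) cP.
  rewrite [in d c](row_sum_delta c) linear_sum summxE /= !mxE => <-.
  by apply: eq_bigr => l _; rewrite linearZ -fP /= !mxE.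
rewrite [in LHS](row_sum_delta y) !linear_sum.
transitivity (\sum_i \sum_l (y 0 i * (f l (p (delta_mx 0 i)) : R)) * c 0 l : R).
  apply: eq_bigr => i _; rewrite !linearZ gE /= scaler_sumr.
  by apply: eq_bigr => l _; rewrite -mulrA.
rewrite exchange_big; apply: eq_bigr => l _; rewrite -mulr_suml.
congr (_ * _); rewrite [in RHS](row_sum_delta y) !linear_sum.
by apply: eq_bigr => i _; rewrite !linearZ.
Qed.

Lemma torsionfree_is_syzygy (X : fpmod R) :
    ascending_chain_condition (@left_ideal R^c) -> torsionfree X ->
  exists N : fpmod R, is_syzygy N X.
Proof.
move=> /(dual_finitely_generated X)[m [f fP]] X_tf.
have j_lin : linear (fun x => \row_l (f l x : R)).
  by move=> a x y; apply/rowP => l; rewrite !mxE linearP.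
apply: (@embedded_is_syzygy R X m (linmap j_lin)) => x y /rowP e.
(* Every functional is a combination of the f l, so agreement of these coordinates forces equal
   evaluations. *)
apply: X_tf; apply: dualP => g; have [c cP] := fP g.
change (g x = g y); rewrite !cP; apply: eq_bigr => l _.
by have := e l; rewrite !mxE => ->.
Qed.

End Torsionfree.

Lemma acc_left_converse (L : pzRingType) :
  ascending_chain_condition (@right_ideal L) ->
  ascending_chain_condition (@left_ideal L^c).
Proof. by move=> acc I; exact: acc. Qed.

Lemma acc_left_converse_converse (L : pzRingType) :
  ascending_chain_condition (@left_ideal L) ->
  ascending_chain_condition (@left_ideal L^c^c).
Proof. by move=> acc I; exact: acc. Qed.

(** * Simple modules over a semiperfect ring *)

Section SimpleModules.
Variable L : pzRingType.
Implicit Types S T : lmodType L^c.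

(** Schur's lemma. *)
Lemma simple_hom_iso (R : pzRingType) (S T : lmodType R) (h : {linear S -> T}) x :
  simple_module S -> simple_module T -> h x <> 0 -> isomorphic S T.
Proof.
move=> [_ S_simple] [_ T_simple] hx; exists h.
have h_inj : injective h.
  have [ker0|kerT] := S_simple _ (kernel_submodule h); last by case: hx.
  move=> y z e; apply/eqP; rewrite -subr_eq0; apply/eqP/ker0.
  by rewrite linearB e subrr.
have h_surj : forall y, exists x, h x = y.
  have [im0|//] := T_simple _ (image_submodule h).
  by case: hx; apply: im0; exists x.
have /choice[g gP] := h_surj.
by exists g => // y; apply: h_inj.
Qed.

(** If J contains the annihilator and some x outside it, then J s is a nonzero submodule, hence
    contains s = y s with y in J; as 1 - y annihilates s, 1 lies in J. *)
Lemma annihilator_maximal S (s : S) : simple_module S -> s <> 0 ->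
  maximal_right_ideal (fun x : L => (x : L^c) *: s = 0).
Proof.
move=> [_ S_simple] s0; split.
- split=> [|x y xs ys|a x xs]; first exact: scale0r.
  + by rewrite scalerDl xs ys addr0.
  + by rewrite -[x * a]/((a : L^c) * (x : L^c)) -scalerA xs scaler0.
- by rewrite scale1r.
move=> J [J0 JD JM] IJ nJ1 x Jx.
have [||h] := S_simple (fun y => exists2 a, J a & (a : L^c) *: s = y).
- split; first by exists 0 => //; rewrite scale0r.
  + move=> _ _ [a Ja <-] [b Jb <-]; exists (a + b); first exact: JD.
    by rewrite scalerDl.
  + move=> a _ [b Jb <-]; exists (b * a); first exact: JM.
    by rewrite scalerA.
- by apply; exists x.
have [y Jy ys] := h s; case: nJ1.
rewrite -[1](subrK y); apply: JD => //; apply: IJ.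
by rewrite scalerBl scale1r ys subrr.
Qed.

(* By the chain condition, the intersection of the annihilators I_j, j > n,   *)
(* lies in I_n for some n. If 1 = a + b along the splitting of I_n modulo the *)
(* radical, then b is not in I_n, hence not in some I_j, and left             *)
(* multiplication by b induces a nonzero map L/I_n -> L/I_j.                  *)
Lemma finitely_many_simples (S : nat -> lmodType L^c) :
    ascending_chain_condition (@right_ideal L) ->
    semisimple_quotient (@jacobson_radical L) ->
    (forall k, simple_module (S k)) ->
  exists k j, (k < j)%N /\ isomorphic (S k) (S j).
Proof.
move=> acc ss S_simple.
have s_ex k : exists s : S k, s <> 0 := (S_simple k).1.
pose s k := sval (cid (s_ex k)).
have s_neq0 k : s k <> 0 := svalP (cid (s_ex k)).
pose I k (x : L) := (x : L^c) *: s k = 0.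
have I_max k : maximal_right_ideal (I k) by exact: annihilator_maximal.
have [||n nP] := acc (fun k x => forall j, (k <= j)%N -> I j x).
- move=> k; split=> [j _|x y Ix Iy j kj|a x Ix j kj].
  + by have [[]] := I_max j.
  + by have [[_ ID _] _ _] := I_max j; apply: ID; [exact: Ix | exact: Iy].
  + by have [[_ _ IM] _ _] := I_max j; apply: IM; exact: Ix.
- by move=> k x Ix j /ltnW; exact: Ix.
have [In_ideal In1 _] := I_max n.
have J_sub x k : jacobson_radical x -> I k x by move=> /(_ _ (I_max k)).
have [B [[B0 BD BM] JB Bsum Bcap]] := ss (I n) In_ideal (fun x => @J_sub x n).
have [a [b [Ia Bb ab]]] := Bsum 1.
have nIb : ~ I n b.
  have [[_ ID _] _ _] := I_max n.
  by move=> Ib; apply: In1; rewrite ab; exact: ID.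
have [j nj nIjb] : exists2 j, (n < j)%N & ~ I j b.
  apply: contrapT => h; apply: nIb; apply: (nP n.+1) => // j nj.
  by apply: contrapT => nIjb; apply: h; exists j.
exists n, j; split=> //.
have sS y : exists x : L, (x : L^c) *: s n = y.
  have scale_lin : linear (fun x : L^c^o => (x : L^c) *: s n).
    by move=> c x x'; rewrite scalerDl scalerA.
  have [h|h] := (S_simple n).2 _ (image_submodule (linmap scale_lin)).
    by case: (s_neq0 n); apply: h; exists 1; exact: scale1r.
  exact: h.
(* For x in I_n, b x = x - a x lies in both I_n and B, hence in the radical, which I_j contains. *)
have well_def x : I n x -> I j (b * x).
  move=> Ix; apply: J_sub; apply: Bcap; last exact: BM.
  have [_ ID IM] := In_ideal.
  have -> : b * x = x + a * (x * -1).
    by rewrite mulrN1 mulrN -[x in x + _]mul1r ab mulrDl addrC addKr.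
  by apply: ID => //; exact: IM.
have [||| h hP] := @linmap_of_rel _ (S n) (S j) (fun y z =>
    exists2 x : L, (x : L^c) *: s n = y & ((b * x : L) : L^c) *: s j = z).
- by move=> y; have [x xy] := sS y; eexists; exists x.
- move=> y z z' [x xy <-] [x' x'y <-]; apply/eqP; rewrite -subr_eq0 -scalerBl.
  apply/eqP; have := @well_def (x - x'); rewrite /I mulrBr; apply.
  by rewrite scalerBl xy x'y subrr.
- move=> c y y' z z' [x <- <-] [x' <- <-]; exists (x * c + x').
    by rewrite scalerDl scalerA.
  by rewrite mulrDr mulrA scalerDl scalerA.
apply: (@simple_hom_iso _ _ _ h (s n)) => // hs0.
have [x xs] := hP (s n); rewrite hs0 => bx0; apply: nIjb.
have Ix : I n (1 - x) by rewrite /I scalerBl xs scale1r subrr.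
rewrite -[b]mulr1 -[1](subrK x) mulrDr; have [[_ ID _] _ _] := I_max j.
by apply: ID bx0; exact: well_def.
Qed.

End SimpleModules.

(** * Suprema and the bound on dell *)

Lemma enat_inf_le (A : nat -> Prop) m : A m -> enat_le (enat_inf A) (Some m).
Proof.
move=> Am; rewrite /enat_inf; case: pselect => [exA|[]].
  by case: ex_minnP => k _ /(_ m); apply; exact/asboolP.
by exists m; exact/asboolP.
Qed.

Lemma enat_inf_mem (A : nat -> Prop) m : A m -> exists2 k, enat_inf A = Some k & A k.
Proof.
move=> Am; rewrite /enat_inf; case: pselect => [exA|[]].
  by case: ex_minnP => k /asboolP Ak _; exists k.
by exists m; exact/asboolP.
Qed.

(** The chain condition on left ideals makes X a syzygy of some N; the one on right ideals provides
    an n-th syzygy Y of X, which is an (n+1)-st syzygy of N. *)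
Lemma dell_le (L : pzRingType) n (M : fpmod L^c) :
    noetherian L -> sigma_omega_torsionfree n M ->
  enat_le (dell M) (Some n).
Proof.
move=> [accl accr] [K [X [MK KX X_tf]]]; apply: enat_inf_le.
have [N NX] := torsionfree_is_syzygy (acc_left_converse_converse accl) X_tf.
have [Y XY] := iter_syzygy_exists n X (acc_left_converse accr).
exists K, N, Y; split=> //; last exact: syzygy_stable_retract MK KX XY.
by apply/iter_relSl; exists X.
Qed.

Theorem corollary1p14 (L : pzRingType) (n : fpmod L^c -> nat) :
  noetherian L ->
  semiperfect L ->
  (forall S T : fpmod L^c,
     simple_module S -> simple_module T -> isomorphic S T -> n S = n T) ->
  (forall S : fpmod L^c,
     simple_module S -> sigma_omega_torsionfree (n S) S) ->
  enat_le (dell_ring L) (sup_simple (fun S => Some (n S))) /\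
  sup_simple (fun S => Some (n S)) <> None.
Proof.
move=> noeth [ss _] n_iso n_tf.
(* If n_S were unbounded, there would be a sequence of simple modules along which it strictly
   increases; two of them are isomorphic, against the invariance of n. *)
have [m mP] : exists m, forall S : fpmod L^c, simple_module S -> (n S <= m)%N.
  apply: contrapT => unbounded.
  pose St := {S : fpmod L^c | simple_module S}.
  have St_ex m : exists S : St, (m < n (sval S))%N.
    apply: contrapT => h; apply: unbounded; exists m => S hS.
    rewrite leqNgt; apply/negP => mS; apply: h.
    by exists (exist _ S hS).
  have /choice[next nextP] : forall S : St, exists T : St, (n (sval S) < n (sval T))%N.
    by move=> S; exact: St_ex.
  have [S0 _] := St_ex 0%N.
  pose S k := iter k next S0.
  have [k [j [kj iso]]] := finitely_many_simples (S := fun k => sval (S k))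
    noeth.2 ss (fun k => svalP (S k)).
  have S_mono : forall i, (n (sval (S k)) < n (sval (S (k + i.+1)%N)))%N.
    elim=> [|i IHi]; first by rewrite addn1; exact: nextP.
    by rewrite addnS; apply: ltn_trans IHi _; exact: nextP.
  have := S_mono (j - k.+1)%N; rewrite -addSnnS subnKC //.
  by rewrite (n_iso _ _ (svalP (S k)) (svalP (S j)) iso) ltnn.
(* The supremum is the least upper bound; since m is an upper bound, it is finite and itself an
   upper bound. *)
have [b bE bP] : exists2 b, sup_simple (fun S : fpmod L^c => Some (n S)) = Some b &
    forall a, (exists S : fpmod L^c, simple_module S /\ a = Some (n S)) ->
      enat_le a (Some b).
  by apply: (@enat_inf_mem _ m) => _ [S [hS ->]]; exact: mP.
rewrite bE; split=> //; apply: enat_inf_le => _ [S [hS ->]].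
have nb : (n S <= b)%N by apply: (bP (Some (n S))); exists S.
have := dell_le noeth (n_tf S hS); case: (dell S) => //= c cn.
exact: leq_trans cn nb.
Qed.
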